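(* There exist numerical constants $c_1,c_2>0$ such that the following holds for all integers $n,d\ge1$ and all $p\in(0,1]$. Suppose that the measurement graph on $[n]$ is an Erdős–Rényi random graph with observation rate $p$. If $p\ge\frac{c_1\log n}{n}$, then $\kappa\le\frac1{32}$ with probability at least $1-\frac1{n^{c_2}}$.
   Context: $[n]=\{1,\dots,n\}$. The measurement graph being an Erdős–Rényi random graph with observation rate $p$ means that $\{w_{ij}:1\le i<j\le n\}$ are i.i.d. Bernoulli random variables with $\Pr(w_{ij}=1)=p$, $\Pr(w_{ij}=0)=1-p$, where $w_{ij}$ is the indicator that $(i,j)$ is an edge. Put $w_{ji}=w_{ij}$, $w_{ii}=1$, and $r_i=\sum_{j=1}^nw_{ij}$. Let $D=\mathrm{Diag}(r_1,\dots,r_n)\otimes I_d$, $W=\bar W\otimes I_d$ with $\bar W=(w_{ij})_{i,j=1}^n$, $F=ee^\top\otimes I_d$ with $e\in\mathbb{R}^n$ the all-one vector ($\otimes$ is the Kronecker product), and $$\kappa=\left\|D^{-1}W-\frac1nF\right\|,$$ where $\|\cdot\|$ is the operator norm. *)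

(* Defs.v *)
From HB Require Import structures.
From mathcomp Require Import all_boot all_order all_algebra.
From mathcomp Require Import all_classical all_reals all_analysis.
From mathcomp Require Import mxtens.

Set Implicit Arguments.
Unset Strict Implicit.
Unset Printing Implicit Defensive.

Import Order.TTheory GRing.Theory Num.Theory.
Import numFieldNormedType.Exports.

Local Open Scope classical_set_scope.
Local Open Scope ring_scope.

Definition l2norm (R : realType) (m : nat) (x : 'cV[R]_m) : R :=
  Num.sqrt (\sum_(i < m) x i 0 ^+ 2).

(* [sup] is the real-valued supremum; the set below contains 0 and is bounded
   (finite dimension), so no junk value is involved. *)
Definition opnorm (R : realType) (m k : nat) (A : 'M[R]_(m, k)) : R :=
  sup [set l2norm (A *m x) | x in [set x : 'cV[R]_k | l2norm x <= 1]].

(* Mutual independence of the subfamily (X i)_{i in D}: the product rule over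
   every finite subfamily. *)
Definition mutually_independent (d d' : measure_display)
    (T : measurableType d) (T' : measurableType d') (R : realType)
    (P : probability T R) (I : finType) (D : {set I})
    (X : I -> {RV P >-> T'}) : Prop :=
  forall S : {set I}, S \subset D ->
  forall A : I -> set T', (forall i, i \in S -> measurable (A i)) ->
    P (\bigcap_(i in [set` S]) (X i @^-1` A i)) =
    (\prod_(i in S) P (X i @^-1` A i))%E.

(* w i j is the indicator that {i, j} is an edge. Only the variables with
   i < j are constrained, and only those are used in [adj_mx]. *)
Definition erdos_renyi (disp : measure_display) (T : measurableType disp)
    (R : realType) (P : probability T R) (n : nat) (p : R)
    (w : 'I_n -> 'I_n -> {RV P >-> bool}) : Prop :=
  (forall i j : 'I_n, (i < j)%N -> distribution P (w i j) = bernoulli_prob p) /\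
  mutually_independent [set ij : 'I_n * 'I_n | (ij.1 < ij.2)%N]
    (fun ij => w ij.1 ij.2).

Definition adj_mx (R : realType) (n : nat) (b : 'I_n -> 'I_n -> bool) :
    'M[R]_n :=
  \matrix_(i < n, j < n)
    if i == j then 1 else (if (i < j)%N then b i j else b j i)%:R.

Definition row_sums (R : realType) (n : nat) (Wbar : 'M[R]_n) : 'rV[R]_n :=
  \row_(i < n) \sum_(j < n) Wbar i j.

(* [tensmx] is the Kronecker product. *)
Definition kappa (R : realType) (n d : nat) (Wbar : 'M[R]_n) : R :=
  let D : 'M[R]_(n * d) := tensmx (diag_mx (row_sums Wbar)) 1%:M in
  let W : 'M[R]_(n * d) := tensmx Wbar 1%:M in
  let e : 'cV[R]_n := const_mx 1 in
  let F : 'M[R]_(n * d) := tensmx (e *m e^T) 1%:M in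
  opnorm (invmx D *m W - n%:R^-1 *: F).

(* Main.v *)
(**
Let J be the all-one matrix. Since D^-1 W fixes the all-one vector,
D^-1 W - J/n = D^-1 (W - pJ) (I - J/n), so it suffices to bound the degrees
below by np/4 (exponential moments and a union bound) and the norm of W - pJ
above by np/128. Up to a diagonal of size at most 1, W - pJ is a symmetric
matrix M with independent centered entries, and ||M||^m <= tr M^m for even m.

In E tr M^m, a walk contributes only if it uses each of its edges at least
twice, and then at most p^(number of distinct edges). Such a walk has at most
m/2 distinct edges, so for any b >= 1 the contribution is at most
b^m (p/b^2)^(number of distinct edges). Summed over all walks, building them
one vertex at a time, this is at most n (b (m + np/b^2))^m: the next edge is
either one of at most m old edges or one of n edges costing p/b^2. For a large
constant b, m of order log n and np >= c_1 log n this is n (np/1024)^m, and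
Markov's inequality concludes.
*)

Require Import Defs.
From HB Require Import structures.
From mathcomp Require Import all_boot all_order all_algebra.
From mathcomp Require Import all_classical all_reals all_analysis.
From mathcomp Require Import mxtens ring lra zify.

Import Order.TTheory GRing.Theory Num.Theory.
Import numFieldNormedType.Exports.

Local Open Scope classical_set_scope.
Local Open Scope ring_scope.

(** * Expectations under a product of Bernoulli laws *)

(** A law on finitely many configurations makes every expectation a finite sum; [sampled_edges_prob]
    relates these sums to [P]. *)
Definition product_law {R : realType} {E : finType} (q : E -> R)
    (f : {ffun E -> bool}) : R :=
  \prod_e (if f e then q e else 1 - q e).

Definition expect {R : realType} {E : finType} (q : E -> R)
    (X : {ffun E -> bool} -> R) : R :=
  \sum_f product_law q f * X f.

Section ProductLaw.
Context {R : realType} {E : finType} (q : E -> R)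
  (q01 : forall e, 0 <= q e <= 1).

Lemma product_law_ge0 f : 0 <= product_law q f.
Proof.
apply: prodr_ge0 => e _; case/andP: (q01 e) => *.
by case: ifP; rewrite ?subr_ge0.
Qed.

(** Independence in algebraic form: distributing a product of two-term sums enumerates the
    configurations. *)
Lemma expect_prod (h : E -> bool -> R) :
  expect q (fun f => \prod_e h e (f e)) =
  \prod_e (q e * h e true + (1 - q e) * h e false).
Proof.
rewrite (eq_bigr (fun e =>
  \sum_(b : bool) (if b then q e else 1 - q e) * h e b)); last first.
  by move=> e _; rewrite big_bool.
rewrite bigA_distr_bigA; apply: eq_bigr => f _.
by rewrite -big_split.
Qed.

Lemma expect_cst (c : R) : expect q (fun=> c) = c.
Proof.
have h1 : expect q (fun=> 1) = 1.
  transitivity (expect q (fun f => \prod_(e : E) 1)).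
    by apply: eq_bigr => f _; rewrite big1_eq.
  rewrite (expect_prod (fun _ _ => 1)) big1// => e _.
  by rewrite !mulr1 addrC subrK.
by rewrite -[RHS]mul1r -h1 mulr_suml; apply: eq_bigr => f _; rewrite mulr1.
Qed.

Lemma expect_le X Y : (forall f, X f <= Y f) -> expect q X <= expect q Y.
Proof.
by move=> XY; apply: ler_sum => f _; rewrite ler_wpM2l// product_law_ge0.
Qed.

Lemma expectD X Y : expect q (fun f => X f + Y f) = expect q X + expect q Y.
Proof. by rewrite -big_split; apply: eq_bigr => f _; rewrite mulrDr. Qed.

Lemma expectZ c X : expect q (fun f => c * X f) = c * expect q X.
Proof. by rewrite mulr_sumr; apply: eq_bigr => f _; rewrite mulrCA. Qed.

Lemma expect_sum (I : Type) (r : seq I) (Q : pred I) X :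
  expect q (fun f => \sum_(i <- r | Q i) X i f) =
  \sum_(i <- r | Q i) expect q (X i).
Proof.
by rewrite /expect exchange_big; apply: eq_bigr => f _; rewrite mulr_sumr.
Qed.

End ProductLaw.

(** The moment is 1 for [c = 0] and vanishes for [c = 1]; for c >= 2 it is at most q(1-q) + (1-q)q^2
    <= q <= p, while b^(c-2) >= 1. Writing the bound with [b] covers all multiplicities at once. *)
Lemma bernoulli_central_moment_le {R : realType} (q p b : R) (c : nat) :
  0 <= q <= p -> p <= 1 -> 1 <= b ->
  `|q * (1 - q) ^+ c + (1 - q) * (- q) ^+ c| <=
  b ^+ c * (if (0 < c)%N then p / b ^+ 2 else 1).
Proof.
move=> /andP[q0 qp] p1 b1; have b0 : 0 < b by apply: lt_le_trans b1.
have p0 : 0 <= p by apply: le_trans qp.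
case: c => [|[|c]] /=.
- by rewrite !expr0 !mulr1 addrC subrK normr1.
- rewrite !expr1 mulrN [q * _]mulrC subrr normr0.
  by rewrite !mulr_ge0// ?invr_ge0 ?exprn_ge0// ltW.
have -> : b ^+ c.+2 * (p / b ^+ 2) = b ^+ c * p.
  by rewrite -addn2 exprD -mulrA [p / _]mulrC mulVKf// expf_neq0 ?gt_eqF.
apply: (@le_trans _ _ p); last by rewrite ler_peMl// exprn_ege1.
apply: (le_trans _ qp); apply: le_trans (ler_normD _ _) _.
have q1 : 0 <= 1 - q by lra.
have -> : `|q * (1 - q) ^+ c.+2| = q * (1 - q) ^+ c.+2.
  by apply: ger0_norm; apply: mulr_ge0 => //; apply: exprn_ge0.
have -> : `|(1 - q) * (- q) ^+ c.+2| = (1 - q) * q ^+ c.+2.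
  by rewrite normrM (normrX c.+2) normrN (ger0_norm q0) (ger0_norm q1).
have h1 : (1 - q) ^+ c.+2 <= 1 - q by rewrite exprS ler_piMr ?exprn_ile1//; lra.
have h2 : q ^+ c.+2 <= q * q.
  by rewrite -expr2 -addn2 exprD ler_piMl ?exprn_ile1 ?exprn_ge0//; lra.
apply: (@le_trans _ _ (q * (1 - q) + (1 - q) * (q * q))); last by nra.
by apply: lerD; apply: ler_wpM2l => //; lra.
Qed.

Lemma prod_seq_count {R : realType} {E : finType} (F : E -> R) (es : seq E) :
  \prod_(e <- es) F e = \prod_e F e ^+ count_mem e es.
Proof.
elim: es => [|e es IH]; first by rewrite big_nil big1.
rewrite big_cons IH /= [RHS](eq_bigr (fun i => (if i == e then F i else 1) *
  F i ^+ count_mem i es)); last first.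
  by move=> i _; rewrite eq_sym exprD; case: eqP.
by rewrite big_split /= -big_mkcond big_pred1_eq.
Qed.

(** Grouping equal edges leaves a product of central moments, one per edge, whose order is the
    multiplicity of the edge; each distinct edge costs one factor p/b^2. *)
Lemma expect_prod_centered_le {R : realType} {E : finType} (q : E -> R)
    (p b : R) (es : seq E) :
  (forall e, 0 <= q e <= p) -> p <= 1 -> 1 <= b ->
  `|expect q (fun f => \prod_(e <- es) ((f e)%:R - q e))| <=
  b ^+ size es * (p / b ^+ 2) ^+ size (undup es).
Proof.
move=> qp p1 b1.
under [X in expect q X]funext => f do rewrite prod_seq_count.
rewrite (expect_prod q (fun e (x : bool) => (x%:R - q e) ^+ count_mem e es)).
rewrite normr_prod.
have -> : b ^+ size es * (p / b ^+ 2) ^+ size (undup es) =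
  \prod_e (b ^+ count_mem e es *
           (if (0 < count_mem e es)%N then p / b ^+ 2 else 1)).
  rewrite big_split /=; congr (_ * _).
    by rewrite -prod_seq_count big_const_seq count_predT iter_mulr_1.
  rewrite -big_mkcond /= -[RHS]big_filter big_const_seq count_predT iter_mulr_1.
  congr (_ ^+ _); apply: perm_size; apply: uniq_perm.
  - exact: undup_uniq.
  - by rewrite filter_uniq// index_enum_uniq.
  move=> e; rewrite mem_undup mem_filter mem_index_enum andbT.
  by rewrite -has_count has_pred1.
apply: ler_prod => e _; rewrite normr_ge0 /= sub0r.
exact: bernoulli_central_moment_le.
Qed.

(** * The trace method *)

Fixpoint words (T : finType) (m : nat) : seq (seq T) :=
  if m is m'.+1 then [seq x :: s | x <- enum T, s <- words T m'] else [:: [::]].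

Lemma words_size (T : finType) m s : s \in words T m -> size s = m.
Proof.
elim: m s => [|m IH] s /=; first by rewrite inE => /eqP ->.
by move=> /allpairsP[[x t] /= [_ /IH <- ->]].
Qed.

Lemma big_words {R : realType} (T : finType) m (F : seq T -> R) :
  \sum_(s <- words T m.+1) F s = \sum_x \sum_(s <- words T m) F (x :: s).
Proof. by rewrite big_allpairs_dep big_enum. Qed.

(** Unordered pairs are encoded with the smaller endpoint first; a loop at x is (x, x). *)
Definition edge {n : nat} (x y : 'I_n) : 'I_n * 'I_n :=
  if (x < y)%N then (x, y) else (y, x).

Lemma edgeC {n} (x y : 'I_n) : edge x y = edge y x.
Proof.
rewrite /edge; case: (ltngtP x y) => //= xy.
by have -> : x = y by apply: val_inj.
Qed.

Lemma edge_injl {n} (y : 'I_n) : injective (edge^~ y).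
Proof.
move=> x x'; rewrite /edge; case: ifP => h; case: ifP => h' [] //.
- by move=> ->.
- by move=> <-.
Qed.

(* Extending a walk backwards from y, at most one neighbour per edge already
   visited gives no new edge; all the others cost a factor [a]. *)
Lemma sum_walks_le {R : realType} (n m N : nat) (a : R) :
  0 <= a -> (m <= N)%N ->
  \sum_(x : 'I_n) \sum_(s <- words 'I_n m)
    a ^+ size (undup (pairmap edge x s)) <=
  n%:R * (N%:R + n%:R * a) ^+ m.
Proof.
move=> a0; elim: m => [|m IH] mN.
  rewrite expr0 mulr1 (eq_bigr (fun=> 1)) ?sumr_const ?card_ord//.
  by move=> x _; rewrite /= big_seq1.
have X0 : 0 <= N%:R + n%:R * a by rewrite addr_ge0 ?mulr_ge0.
under eq_bigr do rewrite big_words.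
rewrite exchange_big /= exprSr mulrA.
apply: le_trans (ler_wpM2r X0 (IH (ltnW mN))).
rewrite mulr_suml; apply: ler_sum => y _.
rewrite exchange_big mulr_suml /= big_seq [leRHS]big_seq.
apply: ler_sum => s /words_size sm.
set es := pairmap edge y s.
have -> : \sum_x a ^+ size (undup (edge x y :: es)) =
   a ^+ size (undup es) * \sum_x (if edge x y \in es then 1 else a).
  rewrite mulr_sumr; apply: eq_bigr => x _ /=.
  by case: ifP => _; rewrite ?mulr1// exprSr.
rewrite ler_wpM2l ?exprn_ge0//.
apply: (@le_trans _ _ (\sum_(x : 'I_n) ((edge x y \in es)%:R + a))).
  by apply: ler_sum => x _; case: ifP => _ /=; rewrite ?add0r ?lerDl.
rewrite big_split /= sumr_const card_ord -[a *+ n]mulr_natl lerD2r.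
(* By injectivity of [edge^~ y], at most m neighbours reuse one of the m edges of the walk. Keeping
   [N] apart from m leaves the base of the power fixed during the induction. *)
rewrite -natr_sum ler_nat; apply: leq_trans (ltnW mN).
rewrite -[leqRHS]sm -(size_pairmap edge y s) -/es.
rewrite (eq_bigr (fun x => if edge x y \in es then 1 else 0)%N); last by [].
rewrite -big_mkcond /= sum1_card -(fintype.card_image (@edge_injl n y)).
rewrite cardE; apply: uniq_leq_size; first exact: enum_uniq.
by move=> e; rewrite mem_enum => /fintype.imageP[x xes ->].
Qed.

Lemma expmx_walks {R : realType} (n m : nat) (A : 'M[R]_n) x y :
  (A ^+ m) x y = \sum_(s <- words 'I_n m | last x s == y)
    \prod_(u <- pairmap pair x s) A u.1 u.2.
Proof.
elim: m x => [|m IH] x.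
  rewrite big_mkcond /= big_seq1 /= big_nil expr0 mxE.
  by case: (x == y).
rewrite exprS mxE [RHS]big_mkcond big_words; apply: eq_bigr => z _.
rewrite IH -big_mkcond mulr_sumr /=; apply: eq_bigr => s _.
by rewrite big_cons.
Qed.

Definition centered_mx {R : realType} {n : nat} (q : 'I_n * 'I_n -> R)
    (f : {ffun 'I_n * 'I_n -> bool}) : 'M[R]_n :=
  \matrix_(x, y) ((f (edge x y))%:R - q (edge x y)).

Lemma trmx_centered {R : realType} n (q : 'I_n * 'I_n -> R) f :
  (centered_mx q f)^T = centered_mx q f.
Proof. by apply/matrixP => x y; rewrite !mxE edgeC. Qed.

Lemma expect_trace_le {R : realType} (n m : nat) (q : 'I_n * 'I_n -> R)
    (p b : R) :
  (forall e, 0 <= q e <= p) -> p <= 1 -> 1 <= b ->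
  expect q (fun f => \tr (centered_mx q f ^+ m)) <=
  n%:R * (b * (m%:R + n%:R * (p / b ^+ 2))) ^+ m.
Proof.
move=> qp p1 b1; have b0 : 0 < b by apply: lt_le_trans b1.
(* For n = 0 the bounds on [q] are vacuous and give no sign for [p]. *)
have [n0|n0] := eqVneq n 0%N.
  subst n; rewrite /expect big1 ?mul0r// => f _.
  by rewrite /mxtrace big_ord0 mulr0.
have p0 : 0 <= p.
  case: n q qp n0 => // n q qp _.
  by case/andP: (qp (ord0, ord0)); apply: le_trans.
have a0 : 0 <= p / b ^+ 2 by rewrite divr_ge0// exprn_ge0// ltW.
rewrite expect_sum exprMn mulrCA.
apply: le_trans (ler_wpM2l (exprn_ge0 _ (ltW b0))
  (sum_walks_le n m m _ a0 (leqnn _))).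
rewrite mulr_sumr; apply: ler_sum => x _.
rewrite mulr_sumr /=.
under [X in expect q X]funext => f do rewrite expmx_walks.
rewrite expect_sum big_mkcond /= big_seq [leRHS]big_seq.
apply: ler_sum => s /words_size sm.
have := expect_prod_centered_le q p b (pairmap edge x s) qp p1 b1.
rewrite size_pairmap sm => h.
(* Walks that do not close are absent from the trace, and their share of the bound is
   nonnegative. *)
case: ifP => _; last by rewrite mulr_ge0// exprn_ge0// ltW.
apply: le_trans (ler_norm _) _; apply: le_trans h.
rewrite le_eqVlt; apply/orP; left; apply/eqP; congr (`| _ |).
apply: eq_bigr => f _; congr (_ * _).
elim: s x {sm} => [|y s IH] x /=; first by rewrite !big_nil.
by rewrite !big_cons IH mxE.
Qed.

(** * Operator norms *)

Section SquaredNorm.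
Context {R : realType}.

Definition sqnorm {n : nat} (u : 'cV[R]_n) : R := \sum_i u i 0 ^+ 2.

Lemma sqnorm_ge0 n (u : 'cV[R]_n) : 0 <= sqnorm u.
Proof. by apply: sumr_ge0 => i _; exact: sqr_ge0. Qed.

Lemma sqnormE n (u : 'cV[R]_n) : sqnorm u = (u^T *m u) 0 0.
Proof. by rewrite mxE; apply: eq_bigr => i _; rewrite mxE expr2. Qed.

(** Cauchy-Schwarz, read off from Lagrange's identity. *)
Lemma sum_mul_sqr_le (I : finType) (a b : I -> R) :
  (\sum_i a i * b i) ^+ 2 <= (\sum_i a i ^+ 2) * (\sum_i b i ^+ 2).
Proof.
have : 0 <= \sum_i \sum_j (a i * b j - a j * b i) ^+ 2.
  by apply: sumr_ge0 => i _; apply: sumr_ge0 => j _; exact: sqr_ge0.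
have -> : \sum_i \sum_j (a i * b j - a j * b i) ^+ 2 =
  \sum_i \sum_j (a i ^+ 2 * b j ^+ 2) + \sum_i \sum_j (b i ^+ 2 * a j ^+ 2)
  - 2 * \sum_i \sum_j ((a i * b i) * (a j * b j)).
  rewrite mulr_sumr -sumrN -!big_split; apply: eq_bigr => i _ /=.
  rewrite mulr_sumr -sumrN -!big_split; apply: eq_bigr => j _ /=; ring.
have E (f g : I -> R) : \sum_i \sum_j (f i * g j) = (\sum_i f i) * \sum_j g j.
  by rewrite mulr_suml; apply: eq_bigr => i _; rewrite mulr_sumr.
rewrite !E expr2; lra.
Qed.

(** Cauchy-Schwarz on each row; the trace is the squared Frobenius norm. *)
Lemma sqnormM_le m n (A : 'M[R]_(m, n)) (u : 'cV[R]_n) :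
  sqnorm (A *m u) <= \tr (A *m A^T) * sqnorm u.
Proof.
rewrite mulr_suml; apply: ler_sum => i _.
have -> : (A *m A^T) i i = \sum_j A i j ^+ 2.
  by rewrite mxE; apply: eq_bigr => j _; rewrite mxE expr2.
rewrite mxE.
exact: sum_mul_sqr_le.
Qed.

(** By symmetry ||Au||^2 is the inner product of A^2 u and u. *)
Lemma sqnorm_symM_sqr_le n (A : 'M[R]_n) (u : 'cV[R]_n) : A^T = A ->
  sqnorm (A *m u) ^+ 2 <= sqnorm (A *m A *m u) * sqnorm u.
Proof.
move=> AT; have -> : sqnorm (A *m u) = \sum_i (A *m A *m u) i 0 * u i 0.
  rewrite sqnormE trmx_mul AT.
  transitivity ((u^T *m (A *m (A *m u))) 0 0); first by rewrite !mulmxA.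
  by rewrite mxE; apply: eq_bigr => i _; rewrite mxE mulrC !mulmxA.
exact: sum_mul_sqr_le.
Qed.

Lemma trmxX n (A : 'M[R]_n) m : A^T = A -> (A ^+ m)^T = A ^+ m.
Proof.
move=> AT; elim: m => [|m IH]; first by rewrite expr0 trmx1.
by rewrite {1}exprS trmx_mul IH AT [RHS]exprSr.
Qed.

(** Induction on [j], passing from A to A^2, which is again symmetric. The powers of [sqnorm u] on
    both sides avoid division. *)
Lemma sqnorm_symM_expn_le n (A : 'M[R]_n) (u : 'cV[R]_n) j : A^T = A ->
  sqnorm (A *m u) ^+ (2 ^ j) * sqnorm u <=
  sqnorm (A ^+ (2 ^ j) *m u) * sqnorm u ^+ (2 ^ j).
Proof.
elim: j A => [|j IH] A AT; first by rewrite expn0 !expr1.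
have [u0|u0] := eqVneq (sqnorm u) 0.
  by rewrite u0 mulr0 mulr_ge0 ?sqnorm_ge0// exprn_ge0.
have up : 0 < sqnorm u by rewrite lt_def u0 sqnorm_ge0.
have AAT : (A *m A)^T = A *m A by rewrite trmx_mul AT.
rewrite expnS !exprM.
apply: (@le_trans _ _
  ((sqnorm (A *m A *m u) * sqnorm u) ^+ (2 ^ j) * sqnorm u)).
  apply: ler_wpM2r; first exact: sqnorm_ge0.
  apply: lerXn2r; rewrite ?nnegrE ?mulr_ge0 ?exprn_ge0 ?sqnorm_ge0//.
  exact: sqnorm_symM_sqr_le.
rewrite exprMn mulrAC.
apply: le_trans (ler_wpM2r _ (IH _ AAT)) _.
  by rewrite exprn_ge0 ?sqnorm_ge0.
by rewrite [A ^+ 2]expr2 [sqnorm u ^+ 2]expr2 exprMn !mulrA.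
Qed.

(* ||A||^{2k} <= tr A^{2k}; for [k] a power of two it suffices to iterate
   ||Au||^2 <= ||A^2 u|| ||u|| *)
Lemma sqnorm_symM_trace_le n (A : 'M[R]_n) (t : R) j (u : 'cV[R]_n) :
  A^T = A -> 0 <= t -> \tr (A ^+ (2 * 2 ^ j)) <= t ^+ (2 * 2 ^ j) ->
  sqnorm (A *m u) <= t ^+ 2 * sqnorm u.
Proof.
move=> AT t0 trA.
have [u0|u0] := eqVneq (sqnorm u) 0.
  by apply: le_trans (sqnormM_le _ _ A u) _; rewrite u0 !mulr0.
have up : 0 < sqnorm u by rewrite lt_def u0 sqnorm_ge0.
rewrite -(@ler_pXn2r _ (2 ^ j)) ?nnegrE ?expn_gt0//; last 2 first.
- exact: sqnorm_ge0.
- by rewrite mulr_ge0 ?sqnorm_ge0 ?exprn_ge0.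
rewrite -(ler_pM2r up).
apply: le_trans (sqnorm_symM_expn_le _ _ u j AT) _.
rewrite exprMn mulrAC; apply: ler_wpM2r; first by rewrite exprn_ge0 ?sqnorm_ge0.
(* The Frobenius bound for the symmetric matrix A^(2^j), whose square has the trace bounded by
   hypothesis. *)
apply: le_trans (sqnormM_le _ _ _ u) _.
apply: ler_wpM2r; first exact: sqnorm_ge0.
by rewrite trmxX// -exprM; move: trA; rewrite mul2n -addnn exprD.
Qed.

Lemma l2normE m (x : 'cV[R]_m) : l2norm x = Num.sqrt (sqnorm x).
Proof. by []. Qed.

Lemma opnorm_le m k (A : 'M[R]_(m, k)) (c : R) : 0 <= c ->
  (forall x, sqnorm (A *m x) <= c ^+ 2 * sqnorm x) -> opnorm A <= c.
Proof.
move=> c0 Ac; apply: ge_sup.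
  (* The supremum is over a nonempty set: 0 lies in the unit ball. *)
  exists (l2norm (A *m 0)), 0 => //=.
  by rewrite l2normE /sqnorm big1 ?sqrtr0// => i _; rewrite mxE expr0n.
move=> _ [x /= x1 <-].
rewrite l2normE -[leRHS](ger0_norm c0) -sqrtr_sqr ler_wsqrtr//.
apply: le_trans (Ac x) _; rewrite ler_piMr ?exprn_ge0//.
by rewrite -(sqr_sqrtr (sqnorm_ge0 _ x)) exprn_ile1// sqrtr_ge0.
Qed.

(** The tensor with the identity acts as B on each of the [d] slices [col k], and the squared norms
    of the slices add up. *)
Lemma sqnorm_tens n d (B : 'M[R]_n) (c : R) :
  (forall v, sqnorm (B *m v) <= c * sqnorm v) ->
  forall x : 'cV[R]_(n * d),
    sqnorm (tensmx B (1%:M : 'M[R]_d) *m x) <= c * sqnorm x.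
Proof.
move=> Bc x; pose col k : 'cV[R]_n := \col_i x (mxtens_index (i, k)) 0.
have sumE (F : 'I_(n * d) -> R) :
    \sum_i F i = \sum_k \sum_j F (mxtens_index (j, k)).
  rewrite (reindex (@mxtens_index n d)) /=; last first.
    exists (@mxtens_unindex n d) => i _; first exact: mxtens_indexK.
    exact: mxtens_unindexK.
  by rewrite exchange_big pair_bigA; apply: eq_bigr => -[].
have -> : sqnorm x = \sum_k sqnorm (col k).
  rewrite /sqnorm sumE; apply: eq_bigr => k _.
  by apply: eq_bigr => i _; rewrite mxE.
rewrite /sqnorm sumE mulr_sumr; apply: ler_sum => k _.
apply: le_trans (Bc (col k)); rewrite le_eqVlt; apply/orP; left; apply/eqP.
apply: eq_bigr => i _; congr (_ ^+ 2).
rewrite !mxE sumE exchange_big; apply: eq_bigr => j _.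
rewrite (bigD1 k) //= big1 ?addr0 => [|l lk].
  by rewrite tensmxE !mxE eqxx mulr1.
by rewrite tensmxE !mxE eq_sym (negbTE lk) mulr0 mul0r.
Qed.

End SquaredNorm.

(** * Reduction of kappa to the centered adjacency matrix and the degrees *)

Lemma sqnorm_diag_le {R : realType} n (v : 'rV[R]_n) (c : R) (u : 'cV[R]_n) :
  (forall i, `|v 0 i| <= c) -> sqnorm (diag_mx v *m u) <= c ^+ 2 * sqnorm u.
Proof.
move=> vc; rewrite mulr_sumr; apply: ler_sum => i _.
rewrite mul_diag_mx mxE exprMn ler_wpM2r ?sqr_ge0//.
by rewrite -real_normK ?num_real// lerXn2r ?nnegrE// (le_trans _ (vc i)).
Qed.

(** Subtracting the mean m from every coordinate lowers the sum of squares by n m^2. *)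
Lemma sqnorm_centering_le {R : realType} n (u : 'cV[R]_n) : (0 < n)%N ->
  sqnorm ((1%:M - n%:R^-1 *: const_mx 1) *m u) <= sqnorm u.
Proof.
move=> n0; pose m := n%:R^-1 * \sum_i u i 0.
have nz : (n%:R : R) != 0 by rewrite pnatr_eq0 -lt0n.
have -> : sqnorm ((1%:M - n%:R^-1 *: const_mx 1) *m u) =
    \sum_i (u i 0 - m) ^+ 2.
  apply: eq_bigr => i _; congr (_ ^+ 2).
  rewrite mulmxBl mul1mx -scalemxAl !mxE; congr (_ - _ * _).
  by apply: eq_bigr => j _; rewrite mxE mul1r.
have -> : \sum_i (u i 0 - m) ^+ 2 = sqnorm u - n%:R * m ^+ 2.
  have -> : \sum_i (u i 0 - m) ^+ 2 =
      \sum_i (u i 0 ^+ 2 + (- 2 * m * u i 0 + m ^+ 2)).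
    by apply: eq_bigr => i _; ring.
  rewrite !big_split /= -mulr_sumr sumr_const card_ord -/(sqnorm u).
  have -> : \sum_i u i 0 = n%:R * m by rewrite /m mulrA mulfV// mul1r.
  rewrite -mulr_natl; ring.
by rewrite lerBlDr lerDl mulr_ge0// sqr_ge0.
Qed.

Lemma invmx_right {R : realType} n (A B : 'M[R]_n) :
  A *m B = 1%:M -> invmx A = B.
Proof.
move=> AB; have [uA _] := mulmx1_unit AB.
by rewrite -[LHS]mulmx1 -AB mulKmx.
Qed.

Lemma tensmx11 (R : comPzRingType) m n :
  tensmx (1%:M : 'M[R]_m) (1%:M : 'M[R]_n) = 1%:M.
Proof.
apply/matrixP => i j.
case: (mxtens_indexP i) => i1 i2; case: (mxtens_indexP j) => j1 j2.
rewrite tensmxE !mxE (can_eq (@mxtens_indexK m n)) xpair_eqE -natrM.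
by case: eqP; case: eqP.
Qed.

(** The three factors of [B] have norms at most 1/s, t and 1. *)
Lemma kappa_le {R : realType} n d (W : 'M[R]_n) (p s t : R) :
  (0 < n)%N -> 0 < s -> 0 <= t ->
  (forall i, s <= row_sums W 0 i) ->
  (forall v, sqnorm ((W - const_mx p) *m v) <= t ^+ 2 * sqnorm v) ->
  kappa d W <= t / s.
Proof.
move=> n0 s0 t0 sr Wt; set r := row_sums W.
pose r' : 'rV[R]_n := \row_i (r 0 i)^-1.
pose J : 'M[R]_n := const_mx 1.
have nz : (n%:R : R) != 0 by rewrite pnatr_eq0 -lt0n.
have r0 i : 0 < r 0 i by apply: lt_le_trans (sr i).
have rr' : diag_mx r *m diag_mx r' = 1%:M.
  rewrite mulmx_diag -diag_const_mx; congr diag_mx.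
  by apply/rowP => i; rewrite mxE [r' 0 i]mxE mulfV ?gt_eqF ?r0// mxE.
have r'r : diag_mx r' *m diag_mx r = 1%:M by apply: mulmx1C.
pose B := diag_mx r' *m ((W - const_mx p) *m (1%:M - n%:R^-1 *: J)).
have JJ : J *m J = n%:R *: J.
  apply/matrixP => i j; rewrite !mxE (eq_bigr (fun=> 1)).
    by rewrite sumr_const card_ord mulr1.
  by move=> k _; rewrite !mxE mulr1.
have WJ : W *m J = diag_mx r *m J.
  apply/matrixP => i j; rewrite mul_diag_mx !mxE mulr1.
  by apply: eq_bigr => k _; rewrite mxE mulr1.
(* The term p J is annihilated by I - J/n because J^2 = n J, and D^-1 W J = J because W and D have
   the same row sums. *)
have BE : diag_mx r' *m W - n%:R^-1 *: J = B.
  rewrite /B; have -> : const_mx p = p *: J.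
    by apply/matrixP => i j; rewrite !mxE mulr1.
  rewrite mulmxBl !mulmxBr !mulmx1 -!scalemxAr -!scalemxAl JJ.
  rewrite scalerA -scalemxAr scalerA mulrCA mulVf// mulr1 subrr subr0 WJ.
  by rewrite !mulmxA r'r mul1mx.
rewrite /kappa -/r.
(* Positive row sums make the degree matrix invertible, so [invmx] is a genuine inverse here. *)
have -> : invmx (tensmx (diag_mx r) (1%:M : 'M[R]_d)) =
    tensmx (diag_mx r') 1%:M.
  by apply: invmx_right; rewrite tensmx_mul rr' mulmx1 tensmx11.
rewrite tensmx_mul mulmx1.
have -> : (const_mx 1 : 'cV[R]_n) *m (const_mx 1)^T = J.
  by apply/matrixP => i j; rewrite !mxE big_ord1 !mxE mulr1.
have -> : tensmx (diag_mx r' *m W) (1%:M : 'M[R]_d) -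
    n%:R^-1 *: tensmx J 1%:M = tensmx B 1%:M.
  rewrite -BE.
  apply/matrixP => i j; rewrite [in LHS]mxE [in LHS]mxE.
  by rewrite !mxE mulrBl mulrA.
apply: opnorm_le; first by rewrite divr_ge0// ltW.
apply: sqnorm_tens => v; rewrite /B -!mulmxA.
apply: le_trans (sqnorm_diag_le _ _ s^-1 _ _) _.
  move=> i; rewrite mxE gtr0_norm ?invr_gt0 ?r0//.
  by rewrite lef_pV2 ?posrE ?r0// sr.
rewrite exprMn [t ^+ 2 * _]mulrC -[leRHS]mulrA; apply: ler_wpM2l.
  by rewrite exprn_ge0// invr_ge0 ltW.
apply: le_trans (Wt _) _; apply: ler_wpM2l; first by rewrite exprn_ge0.
exact: sqnorm_centering_le.
Qed.

(** * The random graph: norm of kappa and lower tail of the degrees *)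

(** Rate 0 outside i < j matches [sampled_edges], which is false there, so that the law is a product
    over all ordered pairs. *)
Definition edge_rate {R : realType} {n : nat} (p : R) (e : 'I_n * 'I_n) : R :=
  if (e.1 < e.2)%N then p else 0.

Definition graph_mx (R : realType) {n : nat}
    (f : {ffun 'I_n * 'I_n -> bool}) : 'M[R]_n :=
  adj_mx R (fun i j => f (i, j)).

Lemma graph_mxE {R : realType} {n : nat} (f : {ffun 'I_n * 'I_n -> bool}) i j :
  graph_mx R f i j = if i == j then 1 else (f (edge i j))%:R.
Proof. by rewrite mxE /edge; case: ifP => // _; case: ifP. Qed.

Lemma edge_rate_edge {R : realType} {n : nat} (p : R) (i j : 'I_n) :
  i != j -> edge_rate p (edge i j) = p.
Proof.
rewrite /edge_rate /edge; case: (ltngtP i j) => //= [->//|ij|/val_inj ->].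
  by rewrite ij.
by rewrite eqxx.
Qed.

Lemma kappa_graph_le {R : realType} n d (p : R)
    (f : {ffun 'I_n * 'I_n -> bool}) j :
  0 < p <= 1 -> 256 <= n%:R * p ->
  \tr (centered_mx (edge_rate p) f ^+ (2 * 2 ^ j)) <=
    (n%:R * p / 256) ^+ (2 * 2 ^ j) ->
  (forall i, n%:R * p / 4 <= row_sums (graph_mx R f) 0 i) ->
  kappa d (graph_mx R f) <= 1 / 32.
Proof.
move=> /andP[p0 p1] np trM rs.
have n0 : (0 < n)%N.
  by rewrite lt0n; apply: contraTneq np => ->; rewrite mul0r -ltNge; lra.
set T := n%:R * p in np trM rs *.
have -> : 1 / 32 = (T / 128) / (T / 4) by field; lra.
apply: (@kappa_le _ _ _ _ p) => //; [lra|lra|move=> v].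
set M0 := centered_mx _ _ in trM.
pose dl : 'rV[R]_n := \row_i (1 - p - (f (i, i))%:R).
(* The diagonal of the graph matrix is 1; the correction [dl] has entries of size at most 1 <=
   T/256. *)
have -> : graph_mx R f - const_mx p = M0 + diag_mx dl.
  apply/matrixP => i k; rewrite [in LHS]mxE graph_mxE !mxE.
  have [<-|ik] := eqVneq i k; last by rewrite edge_rate_edge// mulr0n addr0.
  by rewrite /edge /edge_rate ltnn /= ltnn mulr1n; ring.
rewrite mulmxDl.
(* By (a + b)^2 <= 2a^2 + 2b^2, two bounds (T/256)^2 combine into (T/128)^2. *)
apply: (@le_trans _ _ (2 * sqnorm (M0 *m v) + 2 * sqnorm (diag_mx dl *m v))).
  rewrite !mulr_sumr -big_split; apply: ler_sum => i _ /=.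
  rewrite [X in X ^+ 2 <= _]mxE.
  set a := (M0 *m v) i 0; set b := (diag_mx dl *m v) i 0.
  by have := sqr_ge0 (a - b); nra.
have h1 : sqnorm (M0 *m v) <= (T / 256) ^+ 2 * sqnorm v.
  by apply: sqnorm_symM_trace_le trM; [exact: trmx_centered|lra].
have h2 : sqnorm (diag_mx dl *m v) <= (T / 256) ^+ 2 * sqnorm v.
  apply: sqnorm_diag_le => i; rewrite mxE ler_norml.
  by case: (f _) => /=; lra.
lra.
Qed.

Lemma expect_row_sum_le {R : realType} n (p : R) (i : 'I_n) : 0 < p <= 1 ->
  expect (edge_rate p) (fun f => expR (- row_sums (graph_mx R f) 0 i)) <=
  expR (- (n%:R * p / 2)).
Proof.
move=> /andP[p0 p1].
pose S : {set 'I_n * 'I_n} := (edge i @: predC1 i)%SET.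
have Sinj : {in predC1 i &, injective (edge i)}.
  by move=> x y _ _; rewrite ![edge i _]edgeC => /edge_injl.
have SE (F : 'I_n * 'I_n -> R) :
    \prod_e (if e \in S then F e else 1) = \prod_(k | k != i) F (edge i k).
  by rewrite -big_mkcond /S (big_imset _ Sinj).
pose h e (b : bool) : R := if e \in S then expR (- b%:R) else 1.
have -> : (fun f => expR (- row_sums (graph_mx R f) 0 i)) =
    (fun f : {ffun 'I_n * 'I_n -> bool} => expR (-1) * \prod_e h e (f e)).
  apply/funext => f; rewrite /h (SE (fun e => expR (- (f e)%:R))).
  rewrite -expR_sum -expRD; congr expR.
  rewrite mxE (bigD1 i) //= graph_mxE eqxx sumrN opprD; congr (_ - _).
  by apply: eq_bigr => k ki; rewrite graph_mxE eq_sym (negbTE ki).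
rewrite expectZ expect_prod.
have -> : \prod_e (edge_rate p e * h e true + (1 - edge_rate p e) * h e false) =
    \prod_e (if e \in S then edge_rate p e * expR (-1) + (1 - edge_rate p e)
             else 1).
  apply: eq_bigr => e _; rewrite /h; case: ifP => _ /=.
    by rewrite oppr0 expR0 mulr1.
  by rewrite !mulr1 addrC subrK.
rewrite SE (eq_bigr (fun=> p * expR (-1) + (1 - p))); last first.
  by move=> k ki; rewrite edge_rate_edge// eq_sym.
have e1 : expR (-1) <= 2^-1 :> R.
  by rewrite expRN lef_pV2 ?posrE ?expR_gt0// (le_trans _ (expR_ge1Dx 1)).
have e0 : 0 < expR (-1) :> R := expR_gt0 _.
(* Each of the n - 1 edges at [i] gives a factor at most 1 - p/2 <= exp(-p/2). The diagonal entry
   gives exp(-1) <= exp(-p/2), which replaces the missing n-th factor. *)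
apply: (@le_trans _ _ (expR (-1) * \prod_(k < n | k != i) expR (- (p / 2)))).
  rewrite ler_wpM2l ?(ltW e0)//; apply: ler_prod => k _.
  apply/andP; split; first by nra.
  by apply: le_trans (expR_ge1Dx _); nra.
rewrite -expR_sum -expRD ler_expR.
have : \sum_(k < n) (- (p / 2)) = - (n%:R * p / 2).
  by rewrite sumr_const card_ord -mulr_natl; ring.
rewrite (bigD1 i) //=; lra.
Qed.

(** * The Erdos-Renyi law *)

Lemma measure_finite_fibers (disp : measure_display) (T : measurableType disp)
    (R : realType) (P : probability T R) (J : finType) (F : T -> J)
    (Q : pred J) :
  (forall x, measurable (F @^-1` [set x])) ->
  P [set t | Q (F t)] = (\sum_(x | Q x) P (F @^-1` [set x]))%E.
Proof.
move=> mF; rewrite -big_enum fsbig_seq ?enum_uniq//.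
rewrite -measure_fin_bigcup //; last exact: trivIset_preimage1.
congr (P _); apply/seteqP; split=> t /=.
  by move=> Qt; exists (F t) => //=; rewrite mem_enum.
by move=> [x /=]; rewrite mem_enum => Qx ->.
Qed.

Section Sampling.
Context (disp : measure_display) (T : measurableType disp) (R : realType)
  (P : probability T R) (n : nat) (p : R) (w : 'I_n -> 'I_n -> {RV P >-> bool})
  (p01 : 0 < p <= 1) (ERw : erdos_renyi p w).

(** Masking the pairs without i < j fixes the joint law, since [erdos_renyi] constrains [w] only on
    i < j. *)
Definition sampled_edges (t : T) : {ffun 'I_n * 'I_n -> bool} :=
  [ffun e : 'I_n * 'I_n => (e.1 < e.2)%N && w e.1 e.2 t].

Let D : {set 'I_n * 'I_n} := [set ij : 'I_n * 'I_n | (ij.1 < ij.2)%N]%SET.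

Lemma graph_mx_sampled t :
  graph_mx R (sampled_edges t) = adj_mx R (fun i j => w i j t).
Proof.
apply/matrixP => i j; rewrite !mxE !ffunE /=; case: eqP => // ij.
by case: (ltngtP i j) => //= /val_inj.
Qed.

Lemma sampled_edges_fiber (f : {ffun 'I_n * 'I_n -> bool}) :
  (forall e, e \notin D -> f e = false) ->
  sampled_edges @^-1` [set f] =
  \bigcap_(e in [set` D]) (w e.1 e.2 @^-1` [set f e]).
Proof.
move=> fD; apply/seteqP; split=> t /=.
  by move=> <- e /=; rewrite inE ffunE => ->.
move=> h; apply/ffunP => e; rewrite ffunE.
have [eD|eD] := boolP (e \in D).
  by rewrite -(h e eD); move: eD; rewrite inE => ->.
by rewrite fD//; move: eD; rewrite inE => /negbTE ->.
Qed.

Lemma sampled_edges_fiber0 (f : {ffun 'I_n * 'I_n -> bool}) e :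
  e \notin D -> f e ->
  sampled_edges @^-1` [set f] = set0.
Proof.
move=> eD fe; apply/seteqP; split=> t //= h.
by move: fe eD; rewrite -h ffunE inE => /andP[->].
Qed.

Lemma measurable_sampled_edges f : measurable (sampled_edges @^-1` [set f]).
Proof.
have [/forallP fD|] := boolP [forall e, (e \notin D) ==> ~~ f e].
  rewrite sampled_edges_fiber => [|e eD]; last first.
    by apply/negbTE; apply: implyP (fD e) eD.
  apply: fin_bigcap_measurable; first exact: finite_finset.
  by move=> e _; exact: measurable_funPTI.
rewrite negb_forall => /existsP[e]; rewrite negb_imply negbK => /andP[eD fe].
by rewrite (sampled_edges_fiber0 _ e).
Qed.

(** If [f] is true somewhere outside [D], both sides are 0; otherwise the fiber is an intersection
    over [D] and independence applies. *)
Lemma sampled_edges_law f :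
  P (sampled_edges @^-1` [set f]) = (product_law (edge_rate p) f)%:E.
Proof.
have [/forallP fD|] := boolP [forall e, (e \notin D) ==> ~~ f e]; last first.
  rewrite negb_forall => /existsP[e]; rewrite negb_imply negbK => /andP[eD fe].
  rewrite (sampled_edges_fiber0 _ e)// measure0 /product_law (bigD1 e)//= fe.
  by move: eD; rewrite inE /edge_rate => /negbTE ->; rewrite mul0r.
rewrite sampled_edges_fiber => [|e eD]; last first.
  by apply/negbTE; apply: implyP (fD e) eD.
case: ERw => distr indep.
rewrite (indep D (subxx _) (fun e => [set f e])) => [|//].
rewrite (eq_bigr (fun e => (if f e then p else 1 - p)%:E)); last first.
  move=> e; rewrite inE => elt.
  have := distr _ _ elt; move/(congr1 (fun mu => mu [set f e])).
  rewrite /distribution /pushforward => ->.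
  case/andP: p01 => p0 p1.
  rewrite bernoulli_probE ?(ltW p0)//.
  rewrite !diracE; case: (f e).
    by rewrite mem_set// memNset// mule1 mule0 adde0.
  by rewrite memNset// mem_set// mule1 mule0 add0e.
rewrite prodEFin big_mkcond; congr (_%:E); apply: eq_bigr => e _.
rewrite /edge_rate inE; case: ifPn => // elt.
have := fD e; rewrite inE elt /= => /negbTE ->.
by rewrite subr0.
Qed.

Lemma sampled_edges_prob (Q : pred {ffun 'I_n * 'I_n -> bool}) :
  P [set t | Q (sampled_edges t)] =
  (expect (edge_rate p) (fun f => (Q f)%:R))%:E.
Proof.
rewrite measure_finite_fibers; last exact: measurable_sampled_edges.
rewrite (eq_bigr _ (fun f _ => sampled_edges_law f)) sumEFin big_mkcond.
by congr (_%:E); apply: eq_bigr => f _; case: (Q f); rewrite ?mulr1 ?mulr0.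
Qed.

End Sampling.

(** * Choice of the moment and union bound *)

(** The trace is the squared Frobenius norm of A^m; nonnegativity is what Markov's inequality
    requires. *)
Lemma trace_sqr_ge0 {R : realType} n (A : 'M[R]_n) m : A^T = A ->
  0 <= \tr (A ^+ (2 * m)).
Proof.
move=> AT; rewrite mul2n -addnn exprD -{2}(trmxX _ _ m AT).
apply: sumr_ge0 => i _; rewrite mxE; apply: sumr_ge0 => j _.
by rewrite [X in _ * X]mxE -expr2 sqr_ge0.
Qed.

Lemma ln2_ge_half {R : realType} : 2^-1 <= ln 2 :> R.
Proof.
have : ln (1 + - 2^-1) <= - 2^-1 :> R by apply: le_ln1Dx; lra.
have -> : 1 + - 2^-1 = 2^-1 :> R by lra.
by rewrite lnV ?posrE// lerN2.
Qed.

(** With l the integer part of log_2 n, take 2^j the least power of two that is at least l + 1. Then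
    n < 2^(l+1) <= 2^(2^j), and 2^j <= 2(l+1) <= 4l <= 8 ln n. *)
Lemma exists_moment_exponent {R : realType} (n : nat) : (1 < n)%N ->
  exists j, (n <= 2 ^ (2 ^ j))%N /\ (2 ^ j)%:R <= 8 * ln (n%:R) :> R.
Proof.
move=> n1; have /andP[le_n n_lt] := @trunc_log_bounds 2 n isT (ltnW n1).
set l := trunc_log 2 n in le_n n_lt.
have l0 : (0 < l)%N by rewrite trunc_log_gt0.
have /andP[lj jl] := @up_log_bounds 2 l.+1 isT l0.
set j := up_log 2 l.+1 in lj jl.
have j0 : (0 < j)%N by rewrite /j up_log_gt0.
exists j; split.
  by apply: leq_trans (ltnW n_lt) _; rewrite leq_exp2l.
have j4 : (2 ^ j <= 4 * l)%N.
  rewrite -(prednK j0) expnS.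
  by apply: (@leq_trans (2 * l.+1)); [rewrite leq_mul2l /= ltnW|lia].
have h2 : l%:R * ln 2 <= ln n%:R :> R.
  rewrite mulr_natl -(lnXn l (ltr0n R 2)).
  by rewrite ler_ln ?posrE ?exprn_gt0 ?ltr0n ?(ltnW n1)// -natrX ler_nat.
have : (2 ^ j)%:R <= (4 * l)%:R :> R by rewrite ler_nat.
rewrite natrM => h3; apply: le_trans h3 _.
have := ler_wpM2l (ler0n R l) (@ln2_ge_half R); lra.
Qed.

Lemma edge_rate_bounds {R : realType} {n : nat} (p : R) (e : 'I_n * 'I_n) :
  0 <= p ->
  0 <= edge_rate p e <= p.
Proof. by move=> p0; rewrite /edge_rate; case: ifP => _; rewrite lexx p0. Qed.

Lemma expect_trace_scaled_le {R : realType} (n m : nat) (p b : R) :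
  0 < p <= 1 -> 1 <= b -> b ^+ 2 * m%:R <= n%:R * p ->
  expect (edge_rate p) (fun f => \tr (centered_mx (@edge_rate R n p) f ^+ m)) <=
  n%:R * (n%:R * p * (2 / b)) ^+ m.
Proof.
move=> /andP[p0 p1] b1 bm; have b0 : 0 < b by apply: lt_le_trans b1.
have qp (e : 'I_n * 'I_n) := edge_rate_bounds p e (ltW p0).
apply: le_trans (@expect_trace_le R n m _ p b qp p1 b1) _.
rewrite ler_wpM2l// lerXn2r ?nnegrE//.
- rewrite mulr_ge0 ?(ltW b0)// addr_ge0// mulr_ge0//.
  by rewrite divr_ge0 ?exprn_ge0// ltW.
- by rewrite !mulr_ge0 ?invr_ge0 ?(ltW p0) ?(ltW b0).
have -> : b * (m%:R + n%:R * (p / b ^+ 2)) = (b ^+ 2 * m%:R + n%:R * p) / b.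
  by field; rewrite gt_eqF.
by rewrite mulrA ler_pM2r ?invr_gt0//; lra.
Qed.

Lemma prob_kappa_ge {R : realType} (n d j : nat) (p : R) :
  0 < p <= 1 -> 2048 ^+ 2 * (2 * 2 ^ j)%:R <= n%:R * p ->
  1 - n%:R * (4^-1 ^+ (2 * 2 ^ j) + expR (- (n%:R * p / 4))) <=
  expect (edge_rate p) (fun f : {ffun 'I_n * 'I_n -> bool} =>
    (kappa d (graph_mx R f) <= 1 / 32)%R%:R).
Proof.
move=> p01 mT; case/andP: (p01) => p0 p1.
set m := (2 * 2 ^ j)%N in mT *.
have m1 : 1 <= m%:R :> R by rewrite ler1n /m muln_gt0 expn_gt0.
have Mge0 (f : {ffun 'I_n * 'I_n -> bool}) :
    0 <= \tr (centered_mx (@edge_rate R n p) f ^+ m).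
  by rewrite trace_sqr_ge0// trmx_centered.
have graph_le f := @kappa_graph_le R n d p f j p01.
rewrite -/m in graph_le; clearbody m.
set T := n%:R * p in mT graph_le *.
have q01 e : 0 <= @edge_rate R n p e <= 1.
  by case/andP: (edge_rate_bounds p e (ltW p0)) => -> /= /le_trans; apply.
have T256 : 256 <= T.
  by apply: le_trans mT; rewrite expr2; lra.
pose r (f : {ffun 'I_n * 'I_n -> bool}) i := row_sums (graph_mx R f) 0 i.
pose M f := @centered_mx R n (edge_rate p) f.
pose c := (T / 256) ^+ m.
have c0 : 0 < c by apply: exprn_gt0; lra.
(* Markov's inequality and the union bound in one pointwise inequality: where kappa is large, the
   trace ratio or one of the exponentials is at least 1. *)
have key f : 1 <= (kappa d (graph_mx R f) <= 1 / 32)%R%:R +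
    (c^-1 * \tr (M f ^+ m) + \sum_i expR (T / 4) * expR (- r f i)).
  have tr0 : 0 <= c^-1 * \tr (M f ^+ m).
    by rewrite mulr_ge0 ?invr_ge0 ?(ltW c0)//; exact: Mge0.
  have s0 (Q : pred 'I_n) : 0 <= \sum_(i | Q i) expR (T / 4) * expR (- r f i).
    by apply: sumr_ge0 => i _; rewrite mulr_ge0// expR_ge0.
  have [trM|trM] := leP (\tr (M f ^+ m)) c; last first.
    have : 1 <= c^-1 * \tr (M f ^+ m) by rewrite ler_pdivlMl// mulr1 ltW.
    have := s0 predT.
    by have : 0 <= (kappa d (graph_mx R f) <= 1 / 32)%R%:R :> R by []; lra.
  have [/forallP rs|] := boolP [forall i, T / 4 <= r f i].
    rewrite graph_le //= -[leLHS]addr0 lerD// addr_ge0//; exact: s0.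
  rewrite negb_forall => /existsP[i]; rewrite -ltNge => ri.
  rewrite (bigD1 i) //= -expRD; have := s0 (fun k => k != i).
  have : 1 <= expR (T / 4 - r f i) by apply: le_trans (expR_ge1Dx _); lra.
  by have : 0 <= (kappa d (graph_mx R f) <= 1 / 32)%R%:R :> R by []; lra.
have := expect_le _ q01 _ _ key; rewrite expect_cst !expectD expectZ.
have h1 : c^-1 * expect (edge_rate p) (fun f => \tr (M f ^+ m)) <=
    n%:R * 4^-1 ^+ m.
  rewrite ler_pdivrMl//.
  apply: le_trans (expect_trace_scaled_le n m p 2048 p01 _ mT) _; first lra.
  (* With b = 2048 the trace base 2T/b is a quarter of the threshold T/256, which leaves 4^-m. *)
  have -> : n%:R * p * (2 / 2048) = T / 256 * 4^-1 by rewrite /T; lra.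
  by rewrite exprMn mulrCA.
have h2 : expect (edge_rate p)
    (fun f => \sum_i expR (T / 4) * expR (- r f i)) <= n%:R * expR (- (T / 4)).
  have -> : n%:R * expR (- (T / 4)) = \sum_(i < n) expR (- (T / 4)).
    by rewrite sumr_const card_ord mulr_natl.
  rewrite expect_sum; apply: ler_sum => i _.
  rewrite expectZ.
  apply: le_trans (ler_wpM2l (expR_ge0 _) (expect_row_sum_le n p i p01)) _.
  by rewrite -expRD ler_expR /T; lra.
move=> h; rewrite lerBlDr mulrDr; apply: le_trans h _.
by rewrite lerD2l; exact: lerD h1 h2.
Qed.

Theorem theorem3 (R : realType) :
  exists c1 c2 : R, 0 < c1 /\ 0 < c2 /\
  forall (n d : nat) (p : R), (0 < n)%N -> (0 < d)%N -> 0 < p <= 1 ->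
  forall (disp : measure_display) (Omega : measurableType disp)
    (P : probability Omega R) (w : 'I_n -> 'I_n -> {RV P >-> bool}),
  erdos_renyi p w ->
  c1 * ln n%:R / n%:R <= p ->
  ((1 - 1 / n%:R `^ c2)%R%:E <=
    P [set omega | (kappa d (adj_mx R (fun i j => w i j omega)) <= 1 / 32)%R])%E.
Proof.
(* [2048 ^+ 2] is kept opaque: [//] would compute it in unary. *)
have [c cE] : {c : R | 2048 ^+ 2 = c} by eexists.
have c1 : 1 <= c by rewrite -cE; apply: exprn_ege1; lra.
(* The factor 16 comes from the moment 2 * 2^j <= 16 ln n, which must satisfy c (2 * 2^j) <= np. *)
exists (c * 16), 1; split; first lra.
split=> [|n d p n0 d0 p01 disp Omega P w ERw np]; first lra.
rewrite powRr1//.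
(* For n = 1 the claimed probability is 0. *)
have [n1|n1] := leqP n 1.
  have nE : n = 1%N by apply/eqP; rewrite eqn_leq n1 n0.
  have -> : 1 - 1 / n%:R = 0 :> R by rewrite nE divr1 subrr.
  exact: measure_ge0.
have [j [nj jln]] := @exists_moment_exponent R n n1.
have N2 : 2 <= n%:R :> R by rewrite ler_nat.
have N0 : 0 < n%:R :> R by lra.
have ln0 : 0 <= ln n%:R :> R by rewrite ln_ge0//; lra.
move: np; rewrite ler_pdivrMr// [p * _]mulrC => np.
have mT : c * (2 * 2 ^ j)%:R <= n%:R * p.
  apply: le_trans np; rewrite -mulrA; apply: ler_wpM2l; first lra.
  by rewrite natrM; lra.
pose Q (f : {ffun 'I_n * 'I_n -> bool}) := kappa d (graph_mx R f) <= 1 / 32.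
have -> : [set omega | kappa d (adj_mx R (fun i j => w i j omega)) <= 1 / 32] =
    [set t | Q (sampled_edges _ _ _ _ _ w t)].
  by apply/seteqP; split=> t /=; rewrite /Q graph_mx_sampled.
rewrite (sampled_edges_prob _ _ _ _ _ p)// lee_fin.
have h : 2048 ^+ 2 * (2 * 2 ^ j)%:R <= n%:R * p by rewrite cE.
apply: le_trans (prob_kappa_ge n d j p p01 h).
rewrite lerD2l lerN2 ler_pdivlMr//.
(* 4^(2 * 2^j) = (2^(2^j))^4 >= n^3. *)
have e1 : 4^-1 ^+ (2 * 2 ^ j) <= n%:R ^- 3 :> R.
  rewrite exprVn lef_pV2 ?posrE ?exprn_gt0// -!natrX ler_nat.
  apply: (@leq_trans ((2 ^ 2 ^ j) ^ 3)); first by rewrite leq_exp2r.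
  by rewrite -expnM -(expnM 2 2) leq_exp2l// mulnA mulnC leq_mul2r orbT.
(* np/4 >= 4c ln n >= 3 ln n, as c >= 1. *)
have e2 : expR (- (n%:R * p / 4)) <= n%:R ^- 3 :> R.
  rewrite expRN lef_pV2 ?posrE ?exprn_gt0 ?expR_gt0//.
  rewrite -[in leLHS](@lnK R n%:R) ?posrE// -expRM_natl ler_expR.
  have := ler_wpM2r ln0 c1; lra.
(* The two failure terms sum to at most 2/n^2, which is at most 1/n since n >= 2. *)
apply: (@le_trans _ _ (n%:R * (n%:R ^- 3 + n%:R ^- 3) * n%:R)).
  by rewrite ler_pM2r// ler_pM2l// lerD.
have -> : n%:R * (n%:R ^- 3 + n%:R ^- 3) * n%:R = 2 / n%:R :> R by field; lra.
by rewrite ler_pdivrMr// mul1r.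
Qed.
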